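(* Consider the shifted mean detection problem with $n$ independent observations and the class of sparse sets $\mathcal{C}=\{\mathcal{S}\subseteq[d]:|\mathcal{S}|=s^*\}$. Suppose one of the following holds: (i) $\beta^{*2}\alpha^2n=o(1)$, $\beta^{*2}s^*=o(1)$, and $\beta^{*2}\alpha^2ns^{*2}/d=o(1)$; (ii) $\beta^{*2}s^{*2}/d=o(1)$, $\beta^{*2}\alpha n=o(1)$, and $\beta^{*2}\alpha^2ns^{*2}/d=o(1)$. Then, for $s^*,d,n$ sufficiently large, $\inf_{\phi}R(\phi)\ge1-\epsilon$ with $\epsilon=o(1)$, where the infimum is over all tests $\phi$.
   Context: Setting: $\mathbb{P}_0=N(\mathbf{0},\mathbf{I}_d)$; for $\mathcal{S}\in\mathcal{C}$, $\mathbb{P}_{\mathcal{S}}=(1-\alpha)N(\mathbf{0},\mathbf{I}_d)+\alpha N(\boldsymbol{\theta}_{\mathcal{S}},\mathbf{I}_d)$ (mixture), where $\alpha\in(0,1]$, $(\boldsymbol{\theta}_{\mathcal{S}})_j=\beta^*>0$ for $j\in\mathcal{S}$ and $0$ otherwise. A test $\phi$ is a (measurable) map from the data matrix $\mathbf{X}\in\mathbb{R}^{n\times d}$, whose rows are the $n$ i.i.d. observations, to $\{0,1\}$; its risk is $R(\phi)=\mathbb{P}_0[\phi(\mathbf{X})=1]+\frac{1}{|\mathcal{C}|}\sum_{\mathcal{S}\in\mathcal{C}}\mathbb{P}_{\mathcal{S}}[\phi(\mathbf{X})=0]$, where the probabilities refer to the $n$-fold product distributions. Asymptotics: $s^*,n,\alpha,\beta^*$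 are sequences indexed by $d\to\infty$ with $s^*,n\to\infty$; standing assumptions $\alpha n\to\infty$ and $\beta^*=o(1)$. *)

(* Defs.v *)
From HB Require Import structures.
From mathcomp Require Import all_boot all_order all_algebra.
From mathcomp Require Import all_classical all_reals all_analysis.
Set Implicit Arguments. Unset Strict Implicit. Unset Printing Implicit Defensive.
Import Order.TTheory GRing.Theory Num.Theory numFieldNormedType.Exports.
Local Open Scope classical_set_scope.
Local Open Scope ring_scope.

Section product_probability.
Context d (T : measurableType d) (R : realType).

Definition cons_pair n (x : T * n.-tuple T) : n.+1.-tuple T :=
  [tuple of x.1 :: x.2].

Let measurable_cons_pair n : measurable_fun [set: T * n.-tuple T] (@cons_pair n).
Proof. exact: measurable_cons measurable_fst measurable_snd. Qed.

HB.instance Definition _ n :=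
  isMeasurableFun.Build _ _ _ _ (@cons_pair n) (@measurable_cons_pair n).

(* The law of n independent T-valued coordinates, the i-th one distributed
   according to P i; see [product_probE]. *)
Fixpoint product_prob n : ('I_n -> probability T R) ->
    probability (n.-tuple T) R :=
  match n with
  | 0%N => fun _ => @dirac _ (0%N.-tuple T) [tuple] R
  | m.+1 => fun P =>
      distribution (P ord0 \x product_prob (fun i => P (lift ord0 i)))%E
                   (@cons_pair m)
  end.

Lemma product_probE n (P : 'I_n -> probability T R) (A : 'I_n -> set T) :
  (forall i, measurable (A i)) ->
  product_prob P [set t | forall i, A i (tnth t i)] =
  (\prod_(i < n) P i (A i))%E.
Proof.
elim: n P A => [|n IHn] P A mA /=.
  by rewrite big_ord0 diracE mem_set//; case.
pose B := [set t : n.-tuple T | forall i, A (lift ord0 i) (tnth t i)].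
have mB : measurable B.
  have -> : B = \bigcap_(i in [set: 'I_n])
      ((fun t : n.-tuple T => tnth t i) @^-1` A (lift ord0 i)).
    by apply/seteqP; split => [t tA i _|t tA i]; [exact: tA|exact: (tA i I)].
  apply: fin_bigcap_measurable => [|i _]; first exact: finite_finset.
  by rewrite -[X in measurable X]setTI; exact: measurable_tnth.
rewrite big_ord_recl -(IHn (fun i => P (lift ord0 i)) (fun i => A (lift ord0 i)))//.
rewrite -product_measure1E// /distribution /pushforward /=; congr (_ _).
apply/seteqP; split => [[x t] xtA|[x t] [/= xA tA] i] /=.
  split => /=; first exact: (xtA ord0).
  by move=> i; have := xtA (lift ord0 i); rewrite tnthS.
case: (unliftP ord0 i) => [j|] ->; first by rewrite tnthS; exact: tA.
exact: xA.
Qed.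

End product_probability.

Section mixture.
Local Open Scope ereal_scope.
Context d (T : measurableType d) (R : realType).
Variables (a : {i01 R}) (P Q : probability T R).

Definition mixture : set T -> \bar R :=
  measure_add (mscale (1 - a%:num)%:nng%R P) (mscale a%:num%:nng%R Q).

Lemma mixtureE A : mixture A = (1 - a%:num)%R%:E * P A + a%:num%:E * Q A.
Proof. exact: measure_addE. Qed.

HB.instance Definition _ := Measure.on mixture.

Let mixture_setT : mixture [set: T] = 1.
Proof. by rewrite mixtureE !probability_setT !mule1 -EFinD subrK. Qed.

HB.instance Definition _ :=
  Measure_isProbability.Build _ _ R mixture mixture_setT.

End mixture.

Section shifted_mean_detection.
Context (R : realType).

Local Notation vec d := (d.-tuple (measurableTypeR R)).

(* The normal distribution on R^d with mean theta and covariance I_d; the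
   second parameter of [normal_prob] is the standard deviation. *)
Definition gaussian d (theta : 'I_d -> R) : probability (vec d) R :=
  product_prob (fun j => normal_prob (theta j) 1).

Definition shift d (beta : R) (S : {set 'I_d}) (j : 'I_d) : R :=
  if j \in S then beta else 0.

Definition null_law d : probability (vec d) R := gaussian (fun=> 0).

Definition alt_law d (alpha : {i01 R}) (beta : R) (S : {set 'I_d}) :
    probability (vec d) R :=
  mixture alpha (null_law d) (gaussian (shift beta S)).

Definition iid n d (P : probability (vec d) R) : probability (n.-tuple (vec d)) R :=
  product_prob (fun _ : 'I_n => P).

Definition sparse_sets d (s : nat) : {set {set 'I_d}} :=
  [set S : {set 'I_d} | #|S| == s]%SET.

(* The data X consists of n rows in R^d; a test phi accepts the alternative
   when phi X = true. *)
Definition risk n d (alpha : {i01 R}) (beta : R) (C : {set {set 'I_d}})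
    (phi : {mfun n.-tuple (vec d) >-> bool}) : \bar R :=
  (iid n (null_law d) [set X | phi X = true] +
   (#|C|%:R^-1)%:E *
     \sum_(S in C) iid n (alt_law alpha beta S) [set X | phi X = false])%E.

End shifted_mean_detection.

(* Main.v *)
Require Import Defs.
From mathcomp Require Import all_boot all_order all_algebra.
From mathcomp Require Import all_classical all_reals all_analysis.
From mathcomp Require Import measurable_realfun normal_distribution.
From mathcomp Require Import zify ring lra.
Set Implicit Arguments. Unset Strict Implicit. Unset Printing Implicit Defensive.
Import Order.TTheory GRing.Theory Num.Theory numFieldNormedType.Exports.
Local Open Scope classical_set_scope.
Local Open Scope ring_scope.

(* The second moment method, applied to a truncated likelihood ratio. Marking
   the set B of rows drawn from the shifted component, the averaged alternative
   becomes a mixture over pairs (S, B) of product Gaussians whose mean is beta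
   on B x S and 0 elsewhere, so the second moment of its likelihood ratio is
   the mean of exp(beta^2 |S cap S'| |B cap B'|) over independent pairs. If
   beta^2 s is small (regime (i)), averaging over B, B' first linearizes the
   exponent in |S cap S'|. In regime (ii) the second moment can diverge,
   because of atypically large B; discarding the B with more than
   3 alpha n elements costs mass exp(- alpha n / 2) and makes beta^2 |B cap B'|
   small, so averaging over S, S' first linearizes the exponent in
   |B cap B'|. Both orders give the same bound
   exp(4 beta^2 alpha^2 n s^2 / d). *)

(** * Densities as change-of-measure identities *)

Section density.
Local Open Scope ereal_scope.
Import HBNNSimple.
Context {d} {T : measurableType d} {R : realType}.
Implicit Types (P Q : {measure set T -> \bar R}) (f : T -> R).

(** Asked of all nonnegative measurable integrands rather than of indicators only, so that it can be
    applied to inner and outer integrals after Tonelli. *)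
Definition has_density P Q f : Prop :=
  [/\ measurable_fun [set: T] f, forall x, (0 <= f x)%R &
      forall g : T -> \bar R, measurable_fun [set: T] g -> (forall x, 0 <= g x) ->
        \int[P]_x g x = \int[Q]_x (g x * (f x)%:E)].

(** The usual extension: from indicators to nonnegative simple functions by linearity, then to
    measurable functions by monotone convergence. *)
Lemma has_density_set P Q f : measurable_fun [set: T] f ->
  (forall x, (0 <= f x)%R) ->
  (forall A, measurable A -> P A = \int[Q]_(x in A) (f x)%:E) ->
  has_density P Q f.
Proof.
move=> mf f0 PE; split=> // g mg g0.
have mfE : measurable_fun [set: T] (EFin \o f) by exact/measurable_EFinP.
have indic_density A : measurable A ->
    \int[P]_x (\1_A x)%:E = \int[Q]_x ((\1_A x)%:E * (f x)%:E).
  move=> mA; rewrite integral_indic// setIT PE// integral_mkcond.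
  apply: eq_integral => x _; rewrite patchE indicE.
  by case: ifP; rewrite ?mul1e ?mul0e.
pose g_ := nnsfun_approx measurableT mg.
have sfun_density n :
    \int[P]_x (g_ n x)%:E = \int[Q]_x ((g_ n x)%:E * (f x)%:E).
  under eq_integral do rewrite fimfunE -fsumEFin//.
  rewrite ge0_integral_fsum//; last 2 first.
  - by move=> r; exact/measurable_EFinP/measurableT_comp.
  - by move=> r x _; rewrite EFinM nnfun_muleindic_ge0.
  under [RHS]eq_integral.
    move=> x _; rewrite fimfunE -fsumEFin// ge0_mule_fsuml; last first.
      by move=> r; rewrite EFinM nnfun_muleindic_ge0.
    over.
  rewrite [RHS]ge0_integral_fsum//; last 2 first.
  - move=> r; apply: emeasurable_funM => //.
    by apply/measurable_EFinP; exact/measurableT_comp.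
  - move=> r x _; apply: mule_ge0; last by rewrite lee_fin.
    by rewrite EFinM nnfun_muleindic_ge0.
  (* A nonnegative simple function takes no value [r < 0], so both terms vanish there; for [r >= 0]
     the constant can be pulled out. *)
  apply: eq_fsbigr => r _; have [r0|r0] := ltP r 0%R.
    rewrite preimage_nnfun0//.
    by rewrite !integral0_eq// => x _; rewrite indic0 mulr0 ?mul0e.
  under eq_integral do rewrite EFinM.
  rewrite ge0_integralZl//; last first.
    by apply/measurable_EFinP; exact/measurable_indic.
  under [RHS]eq_integral do rewrite EFinM -muleA.
  rewrite indic_density// [RHS]ge0_integralZl//.
  - apply: emeasurable_funM => //.
    by apply/measurable_EFinP; exact/measurable_indic.
  - by move=> x _; rewrite mule_ge0 ?lee_fin.
transitivity (limn (fun n => \int[P]_x (g_ n x)%:E)).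
  rewrite -monotone_convergence//=.
  - apply: eq_integral => x _; apply/esym/cvg_lim => //.
    exact: cvg_nnsfun_approx.
  - by move=> n; apply: measurableT_comp.
  - by move=> n x _; rewrite lee_fin.
  - by move=> x _ a b ab; rewrite lee_fin//; exact/lefP/nd_nnsfun_approx.
under eq_fun do rewrite sfun_density.
rewrite -monotone_convergence//=.
- apply: eq_integral => x _; apply/cvg_lim => //.
  by apply: cvgeZr => //; exact: cvg_nnsfun_approx.
- by move=> n; apply: emeasurable_funM => //; exact/measurable_EFinP.
- by move=> n x _; rewrite mule_ge0 ?lee_fin.
- move=> x _ a b ab; rewrite lee_wpmul2r ?lee_fin//.
  exact/lefP/nd_nnsfun_approx.
Qed.

Lemma has_density_setE P Q f A : has_density P Q f -> measurable A ->
  P A = \int[Q]_x ((\1_A x)%:E * (f x)%:E).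
Proof.
move=> [_ _ PE] mA; rewrite -PE.
- by rewrite integral_indic// setIT.
- by apply/measurable_EFinP; exact: measurable_indic.
- by move=> x; rewrite lee_fin.
Qed.

End density.

(** * Likelihood ratios of normal, product and mixture laws, and the second moment bound *)

Lemma has_density_normal (R : realType) (m : R) :
  has_density (normal_prob m 1) (normal_prob 0 1)
    (fun x => expR (m * x - m ^+ 2 / 2)).
Proof.
have pdf_density c : has_density (normal_prob c 1) lebesgue_measure (normal_pdf c (1 : R)).
  apply: has_density_set => //; first exact: measurable_normal_pdf.
  by move=> x; exact: normal_pdf_ge0.
have me : measurable_fun setT (fun x : R => expR (m * x - m ^+ 2 / 2)).
  apply: measurableT_comp => //; exact: measurable_funB.
split; [exact: me|by move=> x; exact: expR_ge0|move=> g mg g0].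
have [_ _ pdf_m] := pdf_density m; rewrite (pdf_m g mg g0).
have [_ _ ->] := pdf_density 0.
(* The ratio of the two Lebesgue densities: [(x ^+ 2 - (x - m) ^+ 2) / 2 = m * x - m ^+ 2 / 2]. *)
- apply: eq_integral => x _; rewrite -muleA -EFinM; congr (_ * _%:E)%E.
  rewrite !normal_pdfE ?oner_neq0// /normal_fun mulrCA -expRD.
  by congr (_ * expR _); field.
- by apply: emeasurable_funM => //; exact/measurable_EFinP.
- by move=> x; rewrite mule_ge0// lee_fin expR_ge0.
Qed.

(** Induction on [n]: a product law is the image under [cons_pair] of its first factor times the
    rest, and Tonelli separates the density of the first factor from the induction hypothesis. *)
Lemma has_density_product d (T : measurableType d) (R : realType) n
    (P Q : 'I_n -> probability T R) (f : 'I_n -> T -> R) :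
  (forall i, has_density (P i) (Q i) (f i)) ->
  has_density (product_prob P) (product_prob Q)
    (fun t => \prod_(i < n) f i (tnth t i)).
Proof.
elim: n P Q f => [|n IHn] P Q f dens.
  split => [| |g mg g0].
  - under eq_fun do rewrite big_ord0; exact: measurable_cst.
  - by move=> x; rewrite big_ord0.
  - by apply: eq_integral => x _; rewrite big_ord0 mule1.
have [mF F0 IH] := IHn _ _ _ (fun i => dens (lift ord0 i)).
have [mf f0 Pf] := dens ord0.
have mprod : measurable_fun [set: n.+1.-tuple T] (fun t => \prod_(i < n.+1) f i (tnth t i)).
  apply: measurable_prod => i _.
  apply: (@measurableT_comp _ _ _ _ _ _ (f i)); last exact: measurable_tnth.
  by have [] := dens i.
have prod_ge0 (t : n.+1.-tuple T) : 0 <= \prod_(i < n.+1) f i (tnth t i).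
  by apply: prodr_ge0 => i _; have [] := dens i.
split=> // g mg g0.
have mcons : measurable_fun setT (@cons_pair _ T n) by exact: measurable_funPT.
have mgp : measurable_fun setT
    (fun t : n.+1.-tuple T => g t * (\prod_(i < n.+1) f i (tnth t i))%:E)%E.
  by apply: emeasurable_funM => //; exact/measurable_EFinP.
have gp0 (t : n.+1.-tuple T) : (0 <= g t * (\prod_(i < n.+1) f i (tnth t i))%:E)%E.
  by rewrite mule_ge0// lee_fin.
have mgc : measurable_fun setT (g \o @cons_pair _ T n) by exact: measurableT_comp.
rewrite /= !ge0_integral_pushforward//= !preimage_setT.
rewrite !fubini_tonelli1//=; last exact: (measurableT_comp mgp).
rewrite /fubini_F Pf; last 2 first.
- by apply: (measurable_fun_fubini_tonelli_F _ mgc) => z; exact: g0.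
- by move=> x; apply: integral_ge0.
apply: eq_integral => x _.
have mgx : measurable_fun setT (fun t => g (cons_pair (x, t))).
  exact: (measurable_fun_pair2 x mgc).
rewrite IH// -ge0_integralZr ?lee_fin//; last 2 first.
- by apply: emeasurable_funM => //; exact/measurable_EFinP.
- by move=> t _; rewrite mule_ge0// lee_fin.
apply: eq_integral => t _; rewrite -muleA -EFinM mulrC; congr (_ * _%:E)%E.
rewrite big_ord_recl; congr (_ * _).
by apply: eq_bigr => i _; rewrite tnthS.
Qed.

Lemma has_density_integral d (T : measurableType d) (R : realType)
    (P Q : probability T R) (f : T -> R) :
  has_density P Q f -> (\int[Q]_x (f x)%:E = 1)%E.
Proof.
move=> [_ _ dens].
have := dens (cst 1%E) (measurable_cst _) (fun _ => lee01).
rewrite integral_cst// mul1e [X in X = _]probability_setT => ->.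
by apply: eq_integral => x _; rewrite mul1e.
Qed.

Lemma has_density_mixture d (T : measurableType d) (R : realType)
    (a : {i01 R}) (P Q : probability T R) (f : T -> R) :
  has_density Q P f ->
  has_density (mixture a P Q) P (fun x => 1 - a%:num + a%:num * f x).
Proof.
move=> [mf f0 Qf].
have a1 : 0 <= 1 - a%:num by rewrite subr_ge0.
have mh : measurable_fun setT (fun x => 1 - a%:num + a%:num * f x).
  by apply: measurable_funD => //; exact: measurable_funM.
split => [//|x|g mg g0]; first by rewrite addr_ge0// mulr_ge0.
rewrite ge0_integral_measure_add// !ge0_integral_mscale//= Qf//.
have mgf : measurable_fun setT (fun x => g x * (f x)%:E)%E.
  by apply: emeasurable_funM => //; exact/measurable_EFinP.
have gf0 x : (0 <= g x * (f x)%:E)%E by rewrite mule_ge0// lee_fin.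
rewrite -!ge0_integralZl ?lee_fin//= -ge0_integralD//.
- apply: eq_integral => x _; rewrite muleCA -EFinM [X in (X + _)%E]muleC.
  by rewrite -ge0_muleDr ?lee_fin// mulr_ge0.
- by move=> x _; rewrite mule_ge0 ?lee_fin.
- exact: measurable_funeM.
- by move=> x _; rewrite mule_ge0 ?lee_fin.
- exact: measurable_funeM.
Qed.

(* Pointwise, [L >= 1 - |1 - L|] and [2 |1 - L| <= c + (1 - L) ^+ 2 / c]. *)
Lemma second_moment_bound d (T : measurableType d) (R : realType)
    (P : probability T R) (A : set T) (L : T -> R) (c M W : R) :
  measurable A -> measurable_fun setT L -> (forall x, 0 <= L x) ->
  (\int[P]_x (L x)%:E = W%:E)%E -> (\int[P]_x (L x ^+ 2)%:E = M%:E)%E ->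
  0 < c ->
  ((1 - c / 2 - (1 + M - 2 * W) / (2 * c))%:E <=
    P A + \int[P]_x ((\1_(~` A) x)%:E * (L x)%:E))%E.
Proof.
move=> mA mL L0 PL PL2 c0.
have mE (f : T -> R) : measurable_fun setT f -> measurable_fun setT (EFin \o f).
  by move=> mf; exact/measurable_EFinP.
have m1 (B : set T) : measurable B -> measurable_fun setT (\1_B : T -> R).
  by move=> mB; exact: measurable_indic.
have mL2 : measurable_fun setT (fun x => L x ^+ 2) by exact: measurable_funX.
have mR : measurable_fun setT (fun x => \1_(~` A) x * L x).
  by apply: measurable_funM => //; apply: m1; exact: measurableC.
have cV0 : 0 <= (2 * c)^-1 by rewrite invr_ge0 mulr_ge0// ltW.
have int_lin (k l : R) (f : T -> R) : 0 <= k -> 0 <= l ->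
    measurable_fun setT f -> (forall x, 0 <= f x) ->
    (\int[P]_x (k + l * f x)%:E = k%:E + l%:E * \int[P]_x (f x)%:E)%E.
  move=> k0 l0 mf f0; under eq_integral do rewrite EFinD EFinM.
  rewrite ge0_integralD//; last 2 first.
  - by move=> x _; rewrite mule_ge0 ?lee_fin.
  - by apply: measurable_funeM; exact: mE.
  rewrite integral_cst// [X in (_ * X)%E]probability_setT mule1 ge0_integralZl//.
  - exact: mE.
  - by move=> x _; rewrite lee_fin.
(* The pointwise inequality is arranged so that every term is nonnegative; the integrals then split
   without any integrability condition. *)
have : (\int[P]_x (1 + c^-1 * L x)%:E <=
    \int[P]_x ((\1_A x + \1_(~` A) x * L x) +
      (c / 2 + (2 * c)^-1 + (2 * c)^-1 * L x ^+ 2))%:E)%E.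
  apply: ge0_le_integral => //.
  - by move=> x _; rewrite lee_fin addr_ge0// mulr_ge0// invr_ge0 ltW.
  - apply: mE; apply: measurable_funD => //; exact: measurable_funM.
  - apply: mE; apply: measurable_funD; apply: measurable_funD => //.
    exact: measurable_funM.
  - move=> x _; rewrite lee_fin !indicE in_setC.
    case: (x \in A) => /=.
      have : 0 <= (2 * c)^-1 * (c ^+ 2 + 1 + L x ^+ 2 - 2 * L x).
        rewrite mulr_ge0//.
        have : 0 <= (1 - L x) ^+ 2 by exact: sqr_ge0.
        have : 0 <= c ^+ 2 by exact: sqr_ge0.
        nra.
      have -> : (2 * c)^-1 * (c ^+ 2 + 1 + L x ^+ 2 - 2 * L x) =
          c / 2 + (2 * c)^-1 + (2 * c)^-1 * L x ^+ 2 - c^-1 * L x.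
        by field; rewrite gt_eqF.
      lra.
    have : 0 <= (2 * c)^-1 * (c - (1 - L x)) ^+ 2 by rewrite mulr_ge0 ?sqr_ge0.
    have -> : (2 * c)^-1 * (c - (1 - L x)) ^+ 2 =
        c / 2 - (1 - L x) + (2 * c)^-1 + (2 * c)^-1 * L x ^+ 2 - c^-1 * L x.
      by field; rewrite gt_eqF.
    lra.
rewrite (int_lin 1 c^-1 L) ?invr_ge0 ?(ltW c0)// PL.
under [X in (_ <= X)%E]eq_integral do rewrite EFinD.
rewrite ge0_integralD//; last 4 first.
- by move=> x _; rewrite lee_fin addr_ge0// mulr_ge0.
- apply: mE; apply: measurable_funD => //; exact: m1.
- move=> x _; rewrite lee_fin !addr_ge0// ?mulr_ge0 ?sqr_ge0//.
    exact: ltW.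
- by apply: mE; apply: measurable_funD => //; exact: measurable_funM.
rewrite (int_lin _ _ (fun x => L x ^+ 2)) ?PL2 ?addr_ge0 ?divr_ge0 ?(ltW c0)//; last first.
  by move=> x; exact: sqr_ge0.
under [X in (_ <= X + _)%E]eq_integral do rewrite EFinD.
rewrite ge0_integralD//; last 3 first.
- by apply: mE; exact: m1.
- by move=> x _; rewrite lee_fin mulr_ge0.
- exact: mE.
under [X in (_ <= _ + X + _)%E]eq_integral do rewrite EFinM.
have [p PA] : exists p : R, P A = p%:E.
  by exists (fine (P A)); rewrite fineK// fin_num_measure.
rewrite integral_indic// setIT -[X in (_ <= X + _ + _)%E]/(P A) PA.
set I := (\int[P]_x _)%E.
have : (0 <= I)%E.
  by apply: integral_ge0 => x _; rewrite -EFinM lee_fin mulr_ge0.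
case: I => [r _| _|//]; last by move=> _; rewrite addey// leey.
rewrite -!(EFinM, EFinD) !lee_fin => H.
have -> : 1 - c / 2 - (1 + M - 2 * W) / (2 * c) =
  1 + c^-1 * W - (c / 2 + (2 * c)^-1 + (2 * c)^-1 * M).
  by field; rewrite gt_eqF.
lra.
Qed.

(** * Moments of Gaussian likelihood ratios and of their finite mixtures *)

Section gaussian_likelihood.
Context (R : realType).
Local Notation vec d := (d.-tuple (measurableTypeR R)).

Definition gauss_lr d (theta : 'I_d -> R) (x : vec d) : R :=
  \prod_(j < d) expR (theta j * tnth x j - theta j ^+ 2 / 2).

(** Each row has its own mean, since marked and unmarked rows will be shifted differently. *)
Definition data_lr n d (theta : 'I_n -> 'I_d -> R) (X : n.-tuple (vec d)) : R :=
  \prod_(i < n) gauss_lr (theta i) (tnth X i).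

Lemma has_density_gaussian d (theta : 'I_d -> R) :
  has_density (gaussian theta) (null_law R d) (gauss_lr theta).
Proof.
exact: (has_density_product (fun j => has_density_normal (theta j))).
Qed.

Lemma has_density_data n d (theta : 'I_n -> 'I_d -> R) :
  has_density (product_prob (fun i => gaussian (theta i)))
    (iid n (null_law R d)) (data_lr theta).
Proof.
exact: (has_density_product (fun i => has_density_gaussian (theta i))).
Qed.

Lemma measurable_data_lr n d (theta : 'I_n -> 'I_d -> R) :
  measurable_fun setT (data_lr theta).
Proof. by have [] := has_density_data theta. Qed.

Lemma data_lr_ge0 n d (theta : 'I_n -> 'I_d -> R) X : 0 <= data_lr theta X.
Proof. by have [] := has_density_data theta. Qed.

Lemma integral_data_lr n d (theta : 'I_n -> 'I_d -> R) :
  (\int[iid n (null_law R d)]_X (data_lr theta X)%:E = 1)%E.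
Proof.
exact: has_density_integral (has_density_data theta).
Qed.

(** Completing the square: the cross term of [(theta + eta) ^+ 2] leaves the exponential of the
    inner product, and the other factor is again a likelihood ratio, of integral 1. *)
Lemma data_lrM n d (theta eta : 'I_n -> 'I_d -> R) X :
  data_lr theta X * data_lr eta X =
  expR (\sum_(i < n) \sum_(j < d) theta i j * eta i j) *
    data_lr (fun i j => theta i j + eta i j) X.
Proof.
rewrite expR_sum -!big_split; apply: eq_bigr => i _ /=.
rewrite expR_sum -!big_split; apply: eq_bigr => j _ /=.
by rewrite -!expRD; congr expR; field.
Qed.

Lemma integral_data_lrM n d (theta eta : 'I_n -> 'I_d -> R) :
  (\int[iid n (null_law R d)]_X (data_lr theta X * data_lr eta X)%:E =
   (expR (\sum_(i < n) \sum_(j < d) theta i j * eta i j))%:E)%E.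
Proof.
under eq_integral do rewrite data_lrM EFinM.
rewrite ge0_integralZl_EFin ?expR_ge0//.
- by rewrite integral_data_lr mule1.
- by move=> X _; rewrite lee_fin data_lr_ge0.
- by apply/measurable_EFinP; exact: measurable_data_lr.
Qed.

Section finite_mixture.
Context n d (I : finType) (w : I -> R) (theta : I -> 'I_n -> 'I_d -> R).
Hypothesis w_ge0 : forall i, 0 <= w i.

Let mlr i : measurable_fun setT (fun X => w i * data_lr (theta i) X).
Proof. by apply: measurable_funM => //; exact: measurable_data_lr. Qed.

Lemma integral_mixture_lr :
  (\int[iid n (null_law R d)]_X (\sum_i w i * data_lr (theta i) X)%:E =
   (\sum_i w i)%:E)%E.
Proof.
under eq_integral do rewrite -sumEFin.
rewrite ge0_integral_sum//; last 2 first.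
- by move=> i; exact/measurable_EFinP.
- by move=> i X _; rewrite lee_fin mulr_ge0 ?data_lr_ge0.
rewrite -sumEFin; apply: eq_bigr => i _.
under eq_integral do rewrite EFinM.
rewrite ge0_integralZl_EFin ?integral_data_lr ?mule1//.
- by move=> X _; rewrite lee_fin data_lr_ge0.
- by apply/measurable_EFinP; exact: measurable_data_lr.
Qed.

Lemma integral_mixture_lr_sqr :
  (\int[iid n (null_law R d)]_X ((\sum_i w i * data_lr (theta i) X) ^+ 2)%:E =
   (\sum_i \sum_k w i * w k *
      expR (\sum_(r < n) \sum_(j < d) theta i r j * theta k r j))%:E)%E.
Proof.
have mM i k : measurable_fun setT
    (fun X => (data_lr (theta i) X * data_lr (theta k) X)%:E).
  by apply/measurable_EFinP/measurable_funM; exact: measurable_data_lr.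
have lrM_ge0 i k X : 0 <= data_lr (theta i) X * data_lr (theta k) X.
  by rewrite mulr_ge0 ?data_lr_ge0.
transitivity (\int[iid n (null_law R d)]_X \sum_(p : I * I)
    (w p.1 * w p.2)%:E * (data_lr (theta p.1) X * data_lr (theta p.2) X)%:E)%E.
  apply: eq_integral => X _; rewrite expr2 big_distrlr/= pair_bigA/= -sumEFin.
  by apply: eq_bigr => p _; rewrite -EFinM mulrACA.
rewrite ge0_integral_sum//; last 2 first.
- by move=> p; exact: measurable_funeM.
- by move=> p X _; rewrite -EFinM lee_fin; apply: mulr_ge0; [exact: mulr_ge0|exact: lrM_ge0].
rewrite pair_bigA/= -sumEFin; apply: eq_bigr => p _.
rewrite ge0_integralZl_EFin ?mulr_ge0//.
  by rewrite integral_data_lrM EFinM.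
by move=> X _; rewrite lee_fin.
Qed.

End finite_mixture.

End gaussian_likelihood.

(** * Exponential inequalities and expansion of powers over subsets *)

Lemma expR_sub1_le (R : realType) (x : R) :
  0 <= x -> x <= 2^-1 -> expR x - 1 <= 2 * x.
Proof.
(* From [(1 - x) * expR x <= 1] and [x <= 2^-1] follows [expR x <= 2], so
   [expR x - 1 <= x * expR x <= 2 * x]. *)
move=> x0 x2; have := expR_ge1Dx (- x); rewrite expRN => e1.
have e0 := expR_gt0 x.
have : (1 - x) * expR x <= 1 by rewrite -ler_pdivlMr ?mul1r// mulrC.
nra.
Qed.

Lemma expr_le_expR (R : realType) (x : R) (k : nat) :
  -1 <= x -> (1 + x) ^+ k <= expR (k%:R * x).
Proof.
move=> x1; rewrite expRM_natl lerXn2r ?nnegrE ?expR_ge0 ?expR_ge1Dx//.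
lra.
Qed.

Lemma exprn_cardE (R : comPzRingType) (T : finType) (D : {set T}) (x : R) :
  x ^+ #|D| = \prod_i (if i \in D then x else 1).
Proof. by rewrite -big_mkcond/= prodr_const. Qed.

(** The product of [u + 1] over [D] is extended to all indices with [u] replaced by 0 outside [D];
    distributivity then kills every subset not contained in [D]. *)
Lemma exprD1_card (R : comPzRingType) (T : finType) (D : {set T}) (u : R) :
  (1 + u) ^+ #|D| = \sum_(A : {set T} | A \subset D) u ^+ #|A|.
Proof.
transitivity (\prod_i ((if i \in D then u else 0) + 1)).
  by rewrite exprn_cardE; apply: eq_bigr => i _; case: ifP; rewrite ?add0r// addrC.
rewrite bigA_distr [RHS]big_mkcond/=; apply: eq_big => [A|A _]; first by rewrite inE.
case: ifPn => [/fintype.subsetP AD|/subsetPn[i iA iD]].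
  rewrite exprn_cardE; apply: eq_bigr => i _.
  by case: ifP => // /AD ->.
by rewrite (bigD1 i)//= iA (negbTE iD) mul0r.
Qed.

(** * Random sets of marked rows *)

Section label_sets.
Context (R : realType) (a : R) (n : nat).
Hypotheses (a_ge0 : 0 <= a) (a_le1 : a <= 1).

(** The law of a random set of rows that contains each row independently with probability [a]. *)
Definition label_weight (B : {set 'I_n}) : R :=
  \prod_(i < n) (if i \in B then a else 1 - a).

Lemma label_weight_ge0 B : 0 <= label_weight B.
Proof. by apply: prodr_ge0 => i _; case: ifP; rewrite ?subr_ge0. Qed.

(** The overlap with a fixed [A] is binomial with parameters [#|A|] and [a]: an index outside [A]
    contributes the factor [a + (1 - a) = 1]. *)
Lemma label_pgf (A : {set 'I_n}) (x : R) :
  \sum_B label_weight B * x ^+ #|A :&: B| = (1 + a * (x - 1)) ^+ #|A|.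
Proof.
transitivity (\prod_i ((if i \in A then a * x else a) + (1 - a))); last first.
  by rewrite exprn_cardE; apply: eq_bigr => i _; case: ifP => _; ring.
rewrite bigA_distr; apply: eq_big => [B|B _]; first by rewrite inE.
rewrite exprn_cardE -big_split; apply: eq_bigr => i _ /=.
by rewrite inE; case: (i \in B); case: (i \in A); rewrite ?mulr1.
Qed.

Lemma label_weight_pgf (x : R) :
  \sum_B label_weight B * x ^+ #|B| = (1 + a * (x - 1)) ^+ n.
Proof.
rewrite -[X in _ ^+ X]card_ord -cardsT -label_pgf.
by apply: eq_bigr => B _; rewrite finset.setTI.
Qed.

Lemma sum_label_weight : \sum_B label_weight B = 1.
Proof.
transitivity (\sum_B label_weight B * 1 ^+ #|B|).
  by apply: eq_bigr => B _; rewrite expr1n mulr1.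
by rewrite label_weight_pgf subrr mulr0 addr0 expr1n.
Qed.

(** Averaging over [B'] and then over [B] shows that the overlap is binomial with parameters [n] and
    [a ^+ 2]. *)
Lemma label_overlap_mgf (u : R) : 0 <= u ->
  \sum_B \sum_B' label_weight B * label_weight B' *
      expR (u * #|B :&: B'|%:R) <=
  expR (n%:R * a ^+ 2 * (expR u - 1)).
Proof.
move=> u0; have e1 : 1 <= expR u by rewrite -expR0 ler_expR.
have -> : \sum_B \sum_B' label_weight B * label_weight B' *
      expR (u * #|B :&: B'|%:R) = (1 + a ^+ 2 * (expR u - 1)) ^+ n.
  transitivity (\sum_B label_weight B * (1 + a * (expR u - 1)) ^+ #|B|).
    apply: eq_bigr => B _; rewrite -label_pgf mulr_sumr.
    by apply: eq_bigr => B' _; rewrite expRM_natr mulrA.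
  by rewrite label_weight_pgf; congr (_ ^+ _); ring.
rewrite -mulrA; apply: expr_le_expR.
have : 0 <= a ^+ 2 * (expR u - 1) by rewrite mulr_ge0 ?sqr_ge0 ?subr_ge0.
lra.
Qed.

(** Chernoff bound at parameter 1/2: since [expR 2^-1 - 1 <= 1], the mean of [expR (#|B|%:R / 2)] is
    at most [expR an], and the threshold [3 * an] contributes [expR (- (3 * an / 2))]. *)
Lemma label_tail :
  \sum_(B : {set 'I_n} | 3 * (a * n%:R) < #|B|%:R) label_weight B <= expR (- (a * n%:R / 2)).
Proof.
pose an := a * n%:R.
have pgf_le : \sum_B label_weight B * expR (#|B|%:R / 2 - 3 * an / 2) <=
    expR (- (an / 2)).
  have -> : \sum_B label_weight B * expR (#|B|%:R / 2 - 3 * an / 2) =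
      (1 + a * (expR 2^-1 - 1)) ^+ n * expR (- (3 * an / 2)).
    rewrite -label_weight_pgf mulr_suml; apply: eq_bigr => B _.
    by rewrite expRD expRM_natl mulrA.
  have e2 : expR 2^-1 - 1 <= 1 :> R.
    by rewrite (le_trans (expR_sub1_le _ _))// divff.
  have e0 : 0 <= expR 2^-1 - 1 :> R.
    by rewrite subr_ge0 -expR0 ler_expR.
  apply: (@le_trans _ _ (expR an * expR (- (3 * an / 2)))).
    rewrite ler_wpM2r ?expR_ge0//.
    apply: le_trans (expr_le_expR _ _) _.
      have := mulr_ge0 a_ge0 e0; lra.
    rewrite ler_expR /an mulrCA mulrA ler_piMr// mulr_ge0//.
  by rewrite -expRD ler_expR; lra.
apply: le_trans pgf_le; rewrite big_mkcond/=; apply: ler_sum => B _.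
case: ifP => [H|_]; last by rewrite mulr_ge0 ?label_weight_ge0 ?expR_ge0.
rewrite ler_peMr ?label_weight_ge0//.
have : 0 <= #|B|%:R / 2 - 3 * an / 2 by rewrite -/an in H; lra.
by rewrite -ler_expR expR0.
Qed.

End label_sets.

(** * Overlap of a fixed set with a uniform sparse set *)

Section sparse_overlap.
Context (R : realType) (d s : nat).
Hypotheses (d_gt0 : (0 < d)%N) (s_le : (s <= d)%N).

Lemma card_sparse_sets : #|sparse_sets d s| = 'C(d, s).
Proof. by rewrite /sparse_sets card_draws card_ord. Qed.

(** Removing [A] puts these sets in bijection with the subsets of the complement of [A] of size
    [s - #|A|]. *)
Lemma card_sparse_supset (A : {set 'I_d}) : (#|A| <= s)%N ->
  #|[set S in sparse_sets d s | A \subset S]%SET| = 'C(d - #|A|, s - #|A|).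
Proof.
move=> As; have <- : #|~: A| = (d - #|A|)%N by rewrite cardsCs finset.setCK card_ord.
rewrite -cards_draws -(card_in_imset (f := fun B => A :|: B)); last first.
  move=> B B'; rewrite !inE => /andP[BA _] /andP[BA' _] /(congr1 (fun D => D :\: A)).
  rewrite !finset.setDUl finset.setDv !finset.set0U.
  have dis (D : {set 'I_d}) : D \subset ~: A -> D :\: A = D.
    by move=> DA; apply/finset.setDidPl; rewrite finset.disjoints_subset.
  by rewrite !dis.
apply: eq_card => S; rewrite !inE; apply/andP/imsetP.
  move=> [/eqP Ss AS]; exists (S :\: A).
    by rewrite inE finset.subsetDr cardsDS// Ss eqxx.
  by rewrite finset.setDE finset.setUIr finset.setUCr finset.setIT; apply/esym/finset.setUidPr.
move=> [B]; rewrite inE => /andP[BA /eqP Bc] ->; split; last exact: finset.subsetUl.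
rewrite cardsU (_ : A :&: B = finset.set0) ?cards0 ?subn0 ?Bc ?subnKC//.
by apply/eqP; rewrite finset.setI_eq0 disjoint_sym finset.disjoints_subset.
Qed.

(** A uniform set of size [s] contains given [k] points with probability the product of
    [(s - i) / (d - i)] over [i < k]; each factor is at most [s / d] because [s <= d]. *)
Lemma bin_sub_le k : (k <= s)%N ->
  ('C(d - k, s - k) * d ^ k <= s ^ k * 'C(d, s))%N.
Proof.
elim: k => [|k IH] ks; first by rewrite !subn0 !expn0 muln1 mul1n.
have dk : (0 < d - k)%N by rewrite subn_gt0 (leq_trans ks).
rewrite -(leq_pmul2l dk).
have binE : ((d - k) * 'C(d - k.+1, s - k.+1) = (s - k) * 'C(d - k, s - k))%N.
  by rewrite !subnS mul_bin_diag prednK// subn_gt0.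
rewrite mulnA binE !expnS.
have sd : ((s - k) * d <= (d - k) * s)%N 
  by rewrite !mulnBl [(s * d)%N]mulnC leq_sub2l// leq_mul2l s_le orbT.
have := leq_mul sd (IH (ltnW ks)).
by rewrite (_ : (s - k) * d * _ = (s - k) * 'C(d - k, s - k) * (d * d ^ k))%N ?mulnA//; lia.
Qed.

(** The overlap is hypergeometric, hence not a sum of independent terms. Expanding in powers of
    [u = x - 1 >= 0] over subsets [A] of the overlap leaves inclusion probabilities, at most
    [(s / d) ^ #|A|]; resumming gives a binomial generating function. *)
Lemma sparse_overlap_pgf (S : {set 'I_d}) (x : R) : #|S| = s -> 1 <= x ->
  \sum_(S' in sparse_sets d s) x ^+ #|S :&: S'| <=
  #|sparse_sets d s|%:R * expR (s%:R ^+ 2 / d%:R * (x - 1)).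
Proof.
move=> Ss x1; pose u := x - 1; have u0 : 0 <= u by rewrite subr_ge0.
have d0 : 0 < d%:R :> R by rewrite ltr0n.
rewrite (_ : x = 1 + u); last by rewrite addrC subrK.
under eq_bigr => S' _ do rewrite exprD1_card.
have -> : \sum_(S' in sparse_sets d s) \sum_(A : {set 'I_d} | A \subset S :&: S') u ^+ #|A| =
   \sum_(A : {set 'I_d} | A \subset S) u ^+ #|A| * 'C(d - #|A|, s - #|A|)%:R.
  rewrite (exchange_big_dep (fun A : {set 'I_d} => A \subset S))/=; last first.
    by move=> S' A _; rewrite finset.subsetI => /andP[].
  apply: eq_bigr => A AS; rewrite sumr_const mulr_natr; congr (_ *+ _).
  rewrite -card_sparse_supset -?Ss ?subset_leq_card//.
  by apply: eq_card => S'; rewrite unfold_in finset.subsetI AS !inE.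
apply: (@le_trans _ _ (\sum_(A : {set 'I_d} | A \subset S)
    #|sparse_sets d s|%:R * (u * (s%:R / d%:R)) ^+ #|A|)).
  apply: ler_sum => A AS; rewrite exprMn mulrCA ler_wpM2l ?exprn_ge0//.
  rewrite expr_div_n mulrA ler_pdivlMr ?exprn_gt0// card_sparse_sets.
  rewrite -!natrX -!natrM ler_nat [leqRHS]mulnC; apply: bin_sub_le.
  by rewrite -Ss subset_leq_card.
rewrite -mulr_sumr ler_wpM2l// -exprD1_card Ss.
rewrite (_ : s%:R ^+ 2 / d%:R * (1 + u - 1) = s%:R * (u * (s%:R / d%:R))); last by ring.
apply: expr_le_expR; have : 0 <= u * (s%:R / d%:R) by rewrite !mulr_ge0 ?invr_ge0.
lra.
Qed.

End sparse_overlap.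

(** * The two bounds on the truncated second moment *)

Section second_moment.
Context (R : realType) (n d s : nat) (a beta : R).
Hypotheses (d_gt0 : (0 < d)%N) (s_le : (s <= d)%N).
Hypotheses (a_ge0 : 0 <= a) (a_le1 : a <= 1).
Local Notation C := (sparse_sets d s).
Local Notation w := (label_weight a).

(** The second moment under the null of the averaged likelihood ratio restricted to label sets in
    [K], without renormalizing by the mass of [K]. *)
Definition truncated_moment (K : pred {set 'I_n}) : R :=
  \sum_(S in C) \sum_(S' in C) \sum_(B | K B) \sum_(B' | K B')
    #|C|%:R^-1 ^+ 2 * (w B * w B' *
      expR (beta ^+ 2 * #|S :&: S'|%:R * #|B :&: B'|%:R)).

Let C_gt0 : 0 < #|C|%:R :> R.
Proof. by rewrite ltr0n card_sparse_sets bin_gt0. Qed.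

Lemma sparse_average_le (F : {set 'I_d} -> {set 'I_d} -> R) (b : R) :
  (forall S, S \in C -> \sum_(S' in C) F S S' <= #|C|%:R * b) ->
  \sum_(S in C) \sum_(S' in C) #|C|%:R^-1 ^+ 2 * F S S' <= b.
Proof.
move=> Fb; apply: (@le_trans _ _ (\sum_(S in C) #|C|%:R^-1 * b)).
  apply: ler_sum => S SC; rewrite -mulr_sumr expr2 -mulrA ler_wpM2l ?invr_ge0//.
  by rewrite ler_pdivrMl// Fb.
by rewrite sumr_const -[leLHS]mulr_natl mulrA divff ?mul1r// gt_eqF.
Qed.

Lemma sparse_overlap_mgf (S : {set 'I_d}) (t : R) : S \in C -> 0 <= t -> t <= 2^-1 ->
  \sum_(S' in C) expR (t * #|S :&: S'|%:R) <=
  #|C|%:R * expR (2 * t * (s%:R ^+ 2 / d%:R)).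
Proof.
rewrite inE => /eqP Ss t0 t2; under eq_bigr => S' _ do rewrite expRM_natr.
apply: le_trans (sparse_overlap_pgf d_gt0 s_le Ss _) _.
  by rewrite -expR0 ler_expR.
rewrite ler_wpM2l// ler_expR mulrC ler_wpM2r ?divr_ge0 ?sqr_ge0//.
exact: expR_sub1_le.
Qed.

Lemma label_overlap_mgf_small (u : R) : 0 <= u -> u <= 2^-1 ->
  \sum_(B : {set 'I_n}) \sum_(B' : {set 'I_n}) w B * w B' *
    expR (u * #|B :&: B'|%:R) <= expR (2 * u * (n%:R * a ^+ 2)).
Proof.
move=> u0 u2; apply: le_trans (label_overlap_mgf a n u0) _.
rewrite ler_expR mulrC ler_wpM2r ?mulr_ge0 ?sqr_ge0//.
exact: expR_sub1_le.
Qed.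

Local Notation kappa := (beta ^+ 2 * a ^+ 2 * n%:R * s%:R ^+ 2 / d%:R).

Lemma moment_bound_sparse :
  beta ^+ 2 * s%:R <= 2^-1 -> 2 * (beta ^+ 2 * a ^+ 2 * n%:R) <= 2^-1 ->
  truncated_moment predT <= expR (4 * kappa).
Proof.
move=> bs bn; rewrite /truncated_moment.
under eq_bigr do under eq_bigr do under eq_bigr do rewrite -mulr_sumr.
under eq_bigr do under eq_bigr do rewrite -mulr_sumr.
apply: sparse_average_le => S SC.
have b0 : 0 <= beta ^+ 2 by exact: sqr_ge0.
(* The coefficient of [#|S :&: S'|] left by averaging over the labels. Each of the two
   linearizations costs a factor 2, whence the 4. *)
pose t := 2 * (beta ^+ 2 * a ^+ 2 * n%:R).
have t0 : 0 <= t.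
  by apply: mulr_ge0 => //; apply: mulr_ge0 => //; rewrite mulr_ge0 ?sqr_ge0.
rewrite (_ : 4 * kappa = 2 * t * (s%:R ^+ 2 / d%:R)); last by rewrite /t; ring.
apply: le_trans (sparse_overlap_mgf SC t0 bn); apply: ler_sum => S' _.
apply: le_trans (label_overlap_mgf_small _ _) _.
- by rewrite mulr_ge0.
- apply: le_trans bs; rewrite ler_wpM2l// ler_nat.
  by move: SC; rewrite inE => /eqP <-; rewrite subset_leq_card// finset.subsetIl.
- by rewrite ler_expR (_ : 2 * _ * _ = t * #|S :&: S'|%:R)// /t; ring.
Qed.

Lemma moment_bound_few_labels (m : R) (K : pred {set 'I_n}) :
  (forall B, K B -> #|B|%:R <= m) ->
  beta ^+ 2 * m <= 2^-1 -> 2 * (beta ^+ 2 * s%:R ^+ 2 / d%:R) <= 2^-1 ->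
  truncated_moment K <= expR (4 * kappa).
Proof.
move=> Km bm bs; have b0 : 0 <= beta ^+ 2 by exact: sqr_ge0.
have w0 B : 0 <= w B :> R by exact: label_weight_ge0.
(* The coefficient of [#|B :&: B'|] left by averaging over the sparse sets. *)
pose u := 2 * (beta ^+ 2 * s%:R ^+ 2 / d%:R).
have u0 : 0 <= u by apply: mulr_ge0 => //; apply: divr_ge0 => //; rewrite mulr_ge0 ?sqr_ge0.
rewrite (_ : 4 * kappa = 2 * u * (n%:R * a ^+ 2)); last by rewrite /u; ring.
apply: le_trans (label_overlap_mgf_small u0 bs).
apply: (@le_trans _ _ (\sum_(B | K B) \sum_(B' | K B')
    w B * w B' * expR (u * #|B :&: B'|%:R))); last first.
  rewrite big_mkcond/=; apply: ler_sum => B _.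
  have sum_ge0 : 0 <= \sum_B' w B * w B' * expR (u * #|B :&: B'|%:R).
    by apply: sumr_ge0 => B' _; rewrite !mulr_ge0 ?expR_ge0.
  case: ifP => // _; rewrite [leLHS]big_mkcond/=; apply: ler_sum => B' _.
  by case: ifP => // _; rewrite !mulr_ge0 ?expR_ge0.
rewrite /truncated_moment; under eq_bigr do rewrite exchange_big/=.
rewrite exchange_big/=; apply: ler_sum => B KB.
under eq_bigr do rewrite exchange_big/=.
rewrite exchange_big/=; apply: ler_sum => B' KB'.
apply: sparse_average_le => S SC; rewrite -mulr_sumr mulrCA ler_wpM2l ?mulr_ge0//.
under eq_bigr do rewrite mulrAC.
apply: le_trans (sparse_overlap_mgf SC _ _) _.
- by rewrite mulr_ge0.
- apply: le_trans bm; rewrite ler_wpM2l// (le_trans _ (Km _ KB))// ler_nat.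
  by rewrite subset_leq_card// finset.subsetIl.
- rewrite ler_wpM2l// ler_expR.
  by rewrite (_ : 2 * _ * _ = u * #|B :&: B'|%:R)// /u; ring.
Qed.

End second_moment.

(** * From the truncated second moment to the risk *)

Section risk_bound.
Context (R : realType) (n d s : nat) (alpha : {i01 R}) (beta : R).
Hypotheses (s_le : (s <= d)%N).
Local Notation C := (sparse_sets d s).
Local Notation a := (alpha%:num).
Local Notation w := (label_weight a).
Local Notation vec := (d.-tuple (measurableTypeR R)).

Definition labelled_shift (S : {set 'I_d}) (B : {set 'I_n}) (i : 'I_n) : 'I_d -> R :=
  if i \in B then Defs.shift beta S else fun=> 0.

Lemma labelled_shift_inner S S' B B' :
  \sum_(i < n) \sum_(j < d) labelled_shift S B i j * labelled_shift S' B' i j =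
  beta ^+ 2 * #|S :&: S'|%:R * #|B :&: B'|%:R.
Proof.
have shift_inner : \sum_(j < d) Defs.shift beta S j * Defs.shift beta S' j =
    beta ^+ 2 * #|S :&: S'|%:R.
  rewrite mulr_natr -sumr_const [RHS]big_mkcond/=; apply: eq_bigr => j _.
  by rewrite /Defs.shift inE; case: (j \in S); case: (j \in S'); rewrite ?mulr0 ?mul0r.
rewrite -shift_inner mulr_natr -sumr_const [RHS]big_mkcond/=.
apply: eq_bigr => i _; rewrite inE /labelled_shift.
case: (i \in B); case: (i \in B') => //=; apply: big1 => j _;
  by rewrite ?mulr0 ?mul0r.
Qed.

Definition alt_lr (S : {set 'I_d}) (X : n.-tuple vec) : R :=
  \sum_B w B * data_lr (labelled_shift S B) X.

(** Distributivity expands the product over rows of [1 - a + a * gauss_lr] into a sum over the sets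
    [B] of rows where the shifted component is chosen. *)
Lemma has_density_alt S :
  has_density (iid n (alt_law alpha beta S)) (iid n (null_law R d)) (alt_lr S).
Proof.
have := has_density_product (fun _ : 'I_n =>
  has_density_mixture alpha (has_density_gaussian (Defs.shift beta S))).
rewrite (_ : (fun t => _) = alt_lr S)//; apply/funext => X.
under eq_bigr do rewrite addrC.
rewrite bigA_distr /alt_lr; apply: eq_big => [B|B _]; first by rewrite inE.
rewrite -big_split; apply: eq_bigr => i _ /=.
rewrite /labelled_shift; case: ifP => // _.
(* An unmarked row has mean 0, so its likelihood ratio is 1. *)
rewrite [gauss_lr _ _]big1 ?mulr1// => j _.
by rewrite mul0r expr0n mul0r subr0 expR0.
Qed.

(** Discarding label sets outside [K] only lowers the likelihood ratio, hence the second error term,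
    so [second_moment_bound] may be applied to the truncated ratio. *)
Lemma risk_ge (K : pred {set 'I_n}) (c : R)
    (phi : {mfun n.-tuple vec >-> bool}) : 0 < c ->
  ((1 - c / 2 - (1 + truncated_moment d s a beta K - 2 * \sum_(B | K B) w B) /
      (2 * c))%:E <= risk alpha beta C phi)%E.
Proof.
move=> c0; pose P := iid n (null_law R d).
pose A := [set X | phi X = true]; pose N : R := #|C|%:R^-1.
have mA : measurable A.
  by rewrite -[A]setTI (_ : A = phi @^-1` [set true])//; exact: measurable_funPT.
have AC : [set X | phi X = false] = ~` A.
  by rewrite /A; apply/seteqP; split => X /=; case: (phi X).
have N0 : 0 <= N by rewrite invr_ge0.
have w0 B : 0 <= w B by apply: label_weight_ge0.
(* Setting the weight to 0 off [C] and [K] makes [L] a mixture over one finite type, of total mass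
   the weight of [K]. *)
pose v (p : {set 'I_d} * {set 'I_n}) : R :=
  if (p.1 \in C) && K p.2 then N * w p.2 else 0.
have v0 p : 0 <= v p by rewrite /v; case: ifP => // _; rewrite mulr_ge0.
pose L X := \sum_p v p * data_lr (labelled_shift p.1 p.2) X.
have mL : measurable_fun setT L.
  apply: measurable_sum => p; apply: measurable_funM => //.
  exact: measurable_data_lr.
have L0 X : 0 <= L X.
  by apply: sumr_ge0 => p _; rewrite mulr_ge0 ?data_lr_ge0.
have C_neq0 : (#|C|%:R : R) != 0.
  by rewrite pnatr_eq0 card_sparse_sets -lt0n bin_gt0.
have sum_v (F : {set 'I_d} * {set 'I_n} -> R) :
    \sum_p v p * F p = \sum_(S in C) \sum_(B | K B) N * w B * F (S, B).
  rewrite pair_big/= [RHS]big_mkcond/=; apply: eq_bigr => -[S B] _.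
  by rewrite /v; case: ifP; rewrite ?mul0r.
have PL : (\int[P]_X (L X)%:E = (\sum_(B | K B) w B)%:E)%E.
  rewrite integral_mixture_lr//; congr EFin.
  under eq_bigr do rewrite -[v _]mulr1.
  rewrite sum_v; under eq_bigr do under eq_bigr do rewrite mulr1.
  by rewrite sumr_const -mulr_sumr -[LHS]mulr_natl mulrA divff ?mul1r.
have PL2 : (\int[P]_X (L X ^+ 2)%:E = (truncated_moment d s a beta K)%:E)%E.
  rewrite integral_mixture_lr_sqr//; congr EFin.
  under eq_bigr do under eq_bigr do rewrite -mulrA.
  under eq_bigr do rewrite -mulr_sumr.
  rewrite sum_v /truncated_moment; apply: eq_bigr => S _.
  rewrite [RHS]exchange_big/=; apply: eq_bigr => B _.
  rewrite sum_v mulr_sumr; apply: eq_bigr => S' _.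
  rewrite mulr_sumr; apply: eq_bigr => B' _.
  by rewrite labelled_shift_inner /N; ring.
apply: le_trans (second_moment_bound mA mL L0 PL PL2 c0) _.
rewrite /risk leeD2l// AC.
have mAC : measurable (~` A) by exact: measurableC.
under [X in (_ <= _ * X)%E]eq_bigr => S _ do
  rewrite (has_density_setE (has_density_alt S) mAC).
have malt S : measurable_fun setT (alt_lr S) by have [] := has_density_alt S.
have alt0 S X : 0 <= alt_lr S X by have [_ ->] := has_density_alt S.
have m1 S : measurable_fun setT (fun X => (\1_(~` A) X)%:E * (alt_lr S X)%:E)%E.
  apply: emeasurable_funM; last exact/measurable_EFinP.
  by apply/measurable_EFinP; exact: measurable_indic.
have alt1_ge0 S X : (0 <= (\1_(~` A) X)%:E * (alt_lr S X)%:E)%E.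
  by rewrite -EFinM lee_fin mulr_ge0.
rewrite -big_enum/= -ge0_integral_sum// -ge0_integralZl ?lee_fin//; last 2 first.
- exact: emeasurable_sum.
- by move=> X _; apply: sume_ge0.
apply: ge0_le_integral => //.
- by move=> X _; rewrite -EFinM lee_fin mulr_ge0.
- apply: emeasurable_funM; last exact/measurable_EFinP.
  by apply/measurable_EFinP; exact: measurable_indic.
- by apply: measurable_funeM; exact: emeasurable_sum.
move=> X _; under eq_bigr do rewrite -EFinM.
rewrite sumEFin -!EFinM lee_fin big_enum/= -mulr_sumr mulrCA ler_wpM2l//.
rewrite /L sum_v mulr_sumr; apply: ler_sum => S _.
rewrite /alt_lr mulr_sumr big_mkcond/=; apply: ler_sum => B _.
by case: ifP; rewrite mulrA// !mulr_ge0// data_lr_ge0.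
Qed.

End risk_bound.

(** * Choice of the error term and asymptotics *)

Lemma risk_ge_sqrt (R : realType) (n d s : nat) (alpha : {i01 R}) (beta mu t : R)
    (K : pred {set 'I_n}) (phi : {mfun n.-tuple (d.-tuple (measurableTypeR R)) >-> bool}) :
  (s <= d)%N -> 0 < mu - 1 + 2 * t ->
  truncated_moment d s alpha%:num beta K <= mu ->
  1 - t <= \sum_(B | K B) label_weight alpha%:num B ->
  ((1 - Num.sqrt (mu - 1 + 2 * t))%:E <= risk alpha beta (sparse_sets d s) phi)%E.
Proof.
move=> sd delta0 M_le W_ge; set delta := mu - 1 + 2 * t in delta0 *.
(* The value of [c] that minimizes [c / 2 + delta / (2 * c)]; both terms then equal [c / 2]. *)
have c0 : 0 < Num.sqrt delta by rewrite sqrtr_gt0.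
apply: le_trans (risk_ge alpha beta sd K phi c0); rewrite lee_fin.
set c := Num.sqrt delta in c0 *.
have c2 : c ^+ 2 = delta by rewrite sqr_sqrtr// ltW.
have -> : 1 - c = 1 - c / 2 - c ^+ 2 / (2 * c) by field; rewrite gt_eqF.
rewrite lerD2l lerN2 ler_wpM2r ?invr_ge0 ?mulr_ge0 ?(ltW c0)// c2 /delta; lra.
Qed.

Lemma label_weight_few_ge (R : realType) (n : nat) (a : R) : 0 <= a -> a <= 1 ->
  1 - expR (- (a * n%:R / 2)) <=
  \sum_(B : {set 'I_n} | #|B|%:R <= 3 * (a * n%:R)) label_weight a B.
Proof.
move=> a0 a1; have := sum_label_weight a n.
rewrite (bigID (fun B : {set 'I_n} => #|B|%:R <= 3 * (a * n%:R)))/=.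
under [X in _ + X]eq_bigl do rewrite -ltNge.
have := label_tail n a0 a1; lra.
Qed.

Lemma error_cvg0 (R : realType) (x y : nat -> R) :
  x @ \oo --> 0 -> y d @[d --> \oo] --> +oo ->
  Num.sqrt (expR (4 * x d) - 1 + 2 * expR (- (y d / 2))) @[d --> \oo] --> 0.
Proof.
move=> x0 yoo.
have e1 : expR (4 * x d) @[d --> \oo] --> (1 : R).
  rewrite -[X in _ --> X]expR0; apply: continuous_cvg; first exact: continuous_expR.
  by rewrite -[X in _ --> X](mulr0 (4 : R)); exact: cvgMl_tmp.
have e2 : expR (- (y d / 2)) @[d --> \oo] --> (0 : R).
  apply: (@cvg_comp _ _ _ y (fun z => expR (- (z / 2))) _ _ _ yoo).
  apply: (@cvg_comp _ _ _ (fun z => z / 2) (fun z => expR (- z)) _ (pinfty_nbhs R));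
    last exact: cvgr_expR.
  by apply: (@gt0_cvgMly _ _ _ _ id); rewrite ?invr_gt0//; exact: cvg_id.
rewrite -[X in _ --> X]sqrtr0; apply: continuous_cvg; first exact: sqrt_continuous.
rewrite [X in _ --> X](_ : 0 = 1 - 1 + 2 * 0); last by rewrite subrr mulr0 addr0.
apply: cvgD; first by apply: cvgB => //; exact: cvg_cst.
exact: cvgMl_tmp.
Qed.

Theorem proposition5p4 (R : realType) (s n : nat -> nat)
    (alpha : nat -> {i01 R}) (beta : nat -> R)
    (s_le : forall d, (s d <= d)%N)
    (alpha_gt0 : forall d, 0 < (alpha d)%:num)
    (beta_gt0 : forall d, 0 < beta d)
    (s_oo : s @ \oo --> \oo)
    (n_oo : n @ \oo --> \oo)
    (alpha_n_oo : (alpha d)%:num * (n d)%:R @[d --> \oo] --> +oo)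
    (beta_o1 : beta d @[d --> \oo] --> 0)
    (regime :
      [/\ beta d ^+ 2 * (alpha d)%:num ^+ 2 * (n d)%:R @[d --> \oo] --> 0,
          beta d ^+ 2 * (s d)%:R @[d --> \oo] --> 0 &
          beta d ^+ 2 * (alpha d)%:num ^+ 2 * (n d)%:R * (s d)%:R ^+ 2 / d%:R
            @[d --> \oo] --> 0]
      \/
      [/\ beta d ^+ 2 * (s d)%:R ^+ 2 / d%:R @[d --> \oo] --> 0,
          beta d ^+ 2 * (alpha d)%:num * (n d)%:R @[d --> \oo] --> 0 &
          beta d ^+ 2 * (alpha d)%:num ^+ 2 * (n d)%:R * (s d)%:R ^+ 2 / d%:R
            @[d --> \oo] --> 0]) :
  exists2 eps : nat -> R, eps @ \oo --> 0 &
    \forall d \near \oo,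
      ((1 - eps d)%:E <=
        ereal_inf (range (@risk R (n d) d (alpha d) (beta d)
                            (sparse_sets d (s d)))))%E.
Proof.
pose an d := (alpha d)%:num * (n d)%:R.
pose kappa d :=
  beta d ^+ 2 * (alpha d)%:num ^+ 2 * (n d)%:R * (s d)%:R ^+ 2 / d%:R.
have kappa_cvg : kappa @ \oo --> 0 by case: regime => -[].
(* The quantity of [risk_ge_sqrt] for [mu = expR (4 * kappa d)] and [t = expR (- (an d / 2))].
   Keeping the tail term in regime (i) too gives one error for both regimes and makes [delta]
   strictly positive. *)
pose delta d := expR (4 * kappa d) - 1 + 2 * expR (- (an d / 2)).
exists (fun d => Num.sqrt (delta d)).
  exact: error_cvg0.
have small (f : nat -> R) (r : R) : 0 < r -> f @ \oo --> 0 ->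
    \forall d \near \oo, f d <= r.
  by move=> r0 f0; apply: cvgr_le f0 _ r0.
have kappa_ge0 d : 0 <= kappa d.
  apply: divr_ge0 => //; apply: mulr_ge0; last exact: sqr_ge0.
  by apply: mulr_ge0 => //; apply: mulr_ge0; exact: sqr_ge0.
have delta_gt0 d : 0 < delta d.
  have : 1 <= expR (4 * kappa d) by rewrite -expR0 ler_expR mulr_ge0.
  have := expR_gt0 (- (an d / 2)).
  rewrite /delta; lra.
have a0 d : 0 <= (alpha d)%:num by exact: ltW.
have a1 d : (alpha d)%:num <= 1 by [].
case: regime => [[bn bs _]|[bs bn _]].
- near=> d; apply: le_ereal_inf_tmp => _ [phi _ <-].
  (* In regime (i) no label set is discarded. *)
  apply: (@risk_ge_sqrt _ _ _ _ _ _ _ _ predT) => //.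
  + exact: delta_gt0.
  + apply: moment_bound_sparse => //; near: d.
    * exact: nbhs_infty_gt.
    * exact: small.
    * by apply: filterS (small _ 4^-1 _ bn) => // d; lra.
  + by rewrite sum_label_weight gerBl expR_ge0.
- near=> d; apply: le_ereal_inf_tmp => _ [phi _ <-].
  apply: (@risk_ge_sqrt _ _ _ _ _ _ _ _ (fun B => #|B|%:R <= 3 * an d)) => //.
  + exact: delta_gt0.
  + apply: (moment_bound_few_labels _ _ _ _ (m := 3 * an d)) => //; near: d.
    * exact: nbhs_infty_gt.
    (* The bound 1/6 turns into the required 1/2 through the factor 3 in the truncation level. *)
    * by apply: filterS (small _ 6^-1 _ bn) => // d; rewrite /an; lra.
    * by apply: filterS (small _ 4^-1 _ bs) => // d; lra.
  + exact: label_weight_few_ge.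
Unshelve. all: by end_near. Qed.
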